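(* Let $I$ be a non-principal monomial ideal of $R=K[x_1,\ldots,x_n]$. Then $$\mathrm{depth}(R/I)=\mathrm{depth}(R/\mathrm{sgn}(I)).$$
   Context: $K$ is a field and $R=K[x_1,\ldots,x_n]$ is a polynomial ring with the standard grading. For $a=(a_1,\ldots,a_n)\in\mathbb{N}^n$ (with $0\in\mathbb N$), $x^a:=x_1^{a_1}\cdots x_n^{a_n}$. A monomial ideal $I$ of $R$ has a unique finite minimal set of monomial generators $G(I)=\{x^{v_1},\ldots,x^{v_q}\}$. The incidence matrix of $I$ is the $n\times q$ matrix $A$ with columns $v_1,\ldots,v_q$. Signature: for each row $c=(c_1,\ldots,c_q)$ of $A$, list its distinct entries in ascending order $m_0<m_1<\cdots<m_r$, let $j_i$ be the index with $c_i=m_{j_i}$, and put $\mathrm{sgn}(c)=(j_1,\ldots,j_q)$. The matrix $\mathrm{sgn}(A)$ has rows $\mathrm{sgn}(c)$, with $c$ running over the rows of $A$. The signature $\mathrm{sgn}(I)$ is the ideal of $R$ generated by the monomials $x^w$ with $w$ a column of $\mathrm{sgn}(A)$. *)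

(* Defs.v *)
From HB Require Import structures.
From mathcomp Require Import all_boot all_order all_algebra.
From mathcomp Require Import mpoly.
Set Implicit Arguments.
Unset Strict Implicit.
Unset Printing Implicit Defensive.
Import GRing.Theory.
Local Open Scope ring_scope.

(* Ideals are Prop-valued: membership in an arbitrary ideal of a polynomial    *)
(* ring over an abstract field is not boolean, and the unit ideal is allowed.  *)

Definition same_set (T : Type) (A B : T -> Prop) : Prop :=
  forall x, A x <-> B x.

Definition ideal_gen (R : comNzRingType) (S : R -> Prop) : R -> Prop :=
  fun p => exists s : seq (R * R),
    (forall c, c \in s -> S c.2) /\ p = \sum_(c <- s) c.1 * c.2.

Definition principal (R : comNzRingType) (I : R -> Prop) : Prop :=
  exists g : R, same_set I (ideal_gen (fun p => p = g)).

Definition adjoin (R : comNzRingType) (I : R -> Prop) (fs : seq R) : R -> Prop :=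
  ideal_gen (fun p => I p \/ p \in fs).

(* [fs] is a regular sequence on the module R/I: each term is a nonzerodivisor *)
(* on R/(I, previous terms), and R/(I, fs) is nonzero.                         *)
Definition regular_on_quotient (R : comNzRingType) (I : R -> Prop)
    (fs : seq R) : Prop :=
  (forall i, (i < size fs)%N -> forall g : R,
     adjoin I (take i fs) (fs`_i * g) -> adjoin I (take i fs) g) /\
  ~ adjoin I fs 1.

Definition irrelevant (K : fieldType) (n : nat) : {mpoly K[n]} -> Prop :=
  ideal_gen (fun p => exists i : 'I_n, p = 'X_i).

(* depth (R/I) = d: the largest length of an R/I-regular sequence of elements  *)
(* (not assumed homogeneous) of (x_1, ..., x_n) exists and equals d.           *)
Definition depth_quotient_is (K : fieldType) (n : nat)
    (I : {mpoly K[n]} -> Prop) (d : nat) : Prop :=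
  let regular_in_m (fs : seq {mpoly K[n]}) :=
    (forall f, f \in fs -> irrelevant f) /\ regular_on_quotient I fs in
  (exists fs, regular_in_m fs /\ size fs = d) /\
  (forall fs, regular_in_m fs -> (size fs <= d)%N).

Definition monomial_gen (K : fieldType) (n : nat) (S : 'X_{1..n} -> Prop) :
    {mpoly K[n]} -> Prop :=
  ideal_gen (fun p => exists2 m, S m & p = 'X_[m]).

Definition monomial_ideal (K : fieldType) (n : nat)
    (I : {mpoly K[n]} -> Prop) : Prop :=
  exists S : 'X_{1..n} -> Prop, same_set I (monomial_gen S).

Definition column (n q : nat) (A : 'M[nat]_(n, q)) (j : 'I_q) : 'X_{1..n} :=
  [multinom A i j | i < n].

Definition columns_in (n q : nat) (A : 'M[nat]_(n, q)) (J : {set 'I_q}) :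
    'X_{1..n} -> Prop :=
  fun m => exists2 j, j \in J & m = column A j.

(* The columns of A list G(I) without repetition: a repeated column could be   *)
(* dropped, so minimality over index sets also forces distinctness.  A is thus *)
(* determined by I up to the order of its columns.                             *)
Definition incidence_matrix (K : fieldType) (n q : nat)
    (I : {mpoly K[n]} -> Prop) (A : 'M[nat]_(n, q)) : Prop :=
  same_set I (monomial_gen (columns_in A setT)) /\
  (forall J : {set 'I_q}, J \proper setT ->
     ~ same_set I (monomial_gen (columns_in A J))).

Definition sgn_mx (n q : nat) (A : 'M[nat]_(n, q)) : 'M[nat]_(n, q) :=
  \matrix_(i, j) index (A i j) (sort leq (undup (codom (A i)))).

(* Permuting the columns of A permutes those of sgn_mx A in the same way, so   *)
(* all the incidence matrices of I contribute the same generators.             *)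
Definition sgn_ideal (K : fieldType) (n : nat) (I : {mpoly K[n]} -> Prop) :
    {mpoly K[n]} -> Prop :=
  monomial_gen (fun w => exists (q : nat) (A : 'M[nat]_(n, q)),
    incidence_matrix I A /\ columns_in (sgn_mx A) setT w).

(* Main.v *)
Require Import Defs.
From HB Require Import structures.
From mathcomp Require Import all_boot all_order all_algebra.
From mathcomp Require Import mpoly ring.
From Stdlib Require Import Classical ClassicalEpsilon.

(** The depth of [R/I] is read off from the Koszul homology of the variables on
    [R/I], and for a monomial ideal this homology sees only the order of the
    exponents in each row of the incidence matrix, which is what the signature
    keeps.

    Depth from homology.  If [f] in the irrelevant ideal is regular on [R/J], the
    homology of [R/(J, f)] is nonzero one degree higher than that of [R/J]
    ([koszul_exact_add_elt], [koszul_exact_of_add_elt]).  The homology vanishes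
    above degree [n], and in degree [n] it is the socle; when the socle is zero
    there is a regular element in the irrelevant ideal, by prime avoidance in a
    Noetherian ring ([nonzerodiv_of_socle], [mpoly_noetherian]).  Hence the depth
    is [n - s], with [s] the largest degree of nonzero homology ([depth_koszul]).
    Here [J] is an arbitrary ideal: the elements of a regular sequence need not be
    homogeneous.

    Homology from exponents.  For a proper monomial ideal, the homology of [R/I]
    in degree [i + 1] is the direct sum over [a] of the homology of the complexes
    of those sets [F] of variables for which [x^(a - F)] lies in [I]
    ([acyclic_of_koszul_exact], [koszul_exact_of_acyclic]).  If some [a_v] is not
    an exponent of [x_v] in a generator, membership of [x^(a - F)] does not depend
    on whether [F] contains [v], and the complex is a cone.  Otherwise the complex
    is described by comparisons between entries of the same row of the incidence
    matrix.  Two matrices with the same row orders therefore yield the same nonzero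
    complexes, in different degrees ([acyclic_same_pattern]).

    That [I] is not principal enters only to make both ideals proper: a zero
    column of the signature comes from a generator that divides all the others
    ([sgn_column_neq0]). *)

Set Implicit Arguments.
Unset Strict Implicit.
Unset Printing Implicit Defensive.
Import Order.Theory GRing.Theory.
Local Open Scope ring_scope.

(** * Ideals as predicates *)

Section Ideals.
Variable R : comNzRingType.
Implicit Types (J : R -> Prop) (S : R -> Prop) (f g p q r : R).

Definition is_ideal J :=
  [/\ J 0, forall p q, J p -> J q -> J (p + q) & forall r p, J p -> J (r * p)].

(** The ideal [J + (f)]: a single generator needs a single coefficient, which is
    handier than sums over a list when one element of a regular sequence is
    added at a time. *)
Definition add_elt J f : R -> Prop := fun p => exists r, J (p - f * r).

Definition nonzerodiv J f := forall g, J (f * g) -> J g.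

Lemma ideal0 J : is_ideal J -> J 0. Proof. by case. Qed.

Lemma idealD J p q : is_ideal J -> J p -> J q -> J (p + q).
Proof. by case=> _ D _; apply: D. Qed.

Lemma idealM J r p : is_ideal J -> J p -> J (r * p).
Proof. by case=> _ _ M; apply: M. Qed.

Lemma idealN J p : is_ideal J -> J p -> J (- p).
Proof. by move=> idJ Jp; rewrite -mulN1r; apply: idealM. Qed.

Lemma idealB J p q : is_ideal J -> J p -> J q -> J (p - q).
Proof. by move=> idJ Jp Jq; apply: idealD => //; apply: idealN. Qed.

Lemma ideal_sum J (T : Type) (s : seq T) (P : pred T) (F : T -> R) :
  is_ideal J -> (forall t, P t -> J (F t)) -> J (\sum_(t <- s | P t) F t).
Proof. by case=> J0 D _ JF; apply: (big_ind J). Qed.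

Lemma ideal_congr J p q : is_ideal J -> J (p - q) -> J q -> J p.
Proof. by move=> idJ Jpq Jq; rewrite -(subrK q p); apply: idealD. Qed.

Lemma ideal_gen_is_ideal S : is_ideal (ideal_gen S).
Proof.
split=> [|p q [s [sS ->]] [t [tS ->]]|r p [s [sS ->]]].
- by exists [::]; rewrite big_nil.
- exists (s ++ t); rewrite big_cat; split=> // c.
  by rewrite mem_cat => /orP[/sS|/tS].
- exists [seq (r * c.1, c.2) | c <- s]; split=> [_ /mapP[c + ->]|].
    by move=> cs; apply: (sS c).
  by rewrite big_map big_distrr; apply: eq_bigr => c _ /=; rewrite mulrA.
Qed.

Lemma ideal_gen_sub S J :
  is_ideal J -> (forall p, S p -> J p) -> forall p, ideal_gen S p -> J p.
Proof.
move=> idJ SJ _ [s [sS ->]]; rewrite big_seq.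
by apply: ideal_sum => // c cs; apply: idealM => //; apply/SJ/sS.
Qed.

Lemma sub_ideal_gen S p : S p -> ideal_gen S p.
Proof.
move=> Sp; exists [:: (1, p)]; rewrite big_seq1 mul1r.
by split=> // c; rewrite inE => /eqP->.
Qed.

Lemma add_elt_is_ideal J f : is_ideal J -> is_ideal (add_elt J f).
Proof.
move=> idJ; split=> [|p q [r Jr] [s Js]|r p [s Js]].
- by exists 0; rewrite mulr0 subr0; apply: ideal0.
- exists (r + s).
  by rewrite (_ : p + q - f * (r + s) = (p - f * r) + (q - f * s)); [apply: idealD|ring].
- exists (r * s).
  by rewrite (_ : r * p - f * (r * s) = r * (p - f * s)); [apply: idealM|ring].
Qed.

Lemma sub_add_elt J f p : J p -> add_elt J f p.
Proof. by exists 0; rewrite mulr0 subr0. Qed.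

Lemma add_elt_self J f : is_ideal J -> add_elt J f f.
Proof. by move=> idJ; exists 1; rewrite mulr1 subrr; apply: ideal0. Qed.

End Ideals.

(** * Koszul chains *)

Section Koszul.
Variables (n : nat) (R : comNzRingType).
Implicit Types (z w c : {set 'I_n} -> R) (F : {set 'I_n}) (u v : 'I_n).
Implicit Types (y : 'I_n -> R) (J : R -> Prop).

(** The sign of [e_v] moved to its sorted place in the exterior monomial
    [e_v /\ e_F]. *)
Definition ksign v F : R := (-1) ^+ #|[set u in F | (u < v)%N]|.

(** A Koszul chain is the family of its coordinates [z F] on the exterior basis
    [e_F], all degrees at once; this is its boundary, for the sequence [y].  The
    same formula with every [y v = 1] is the boundary of a simplex. *)
Definition kdiff y z : {set 'I_n} -> R := fun F =>
  \sum_(v | v \notin F) ksign v F * y v * z (v |: F).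

(** Exterior multiplication by [e_v]. *)
Definition khom v z : {set 'I_n} -> R := fun F =>
  if v \in F then ksign v (F :\ v) * z (F :\ v) else 0.

(** Homogeneous chains of homological degree [i]. *)
Definition in_degree i z := forall F, z F != 0 -> #|F| = i.

Lemma ksignU v u F : u \notin F ->
  ksign v (u |: F) = (-1) ^+ (u < v)%N * ksign v F.
Proof.
move=> uF; rewrite /ksign; case: (boolP (u < v)%N) => ltuv; last first.
  rewrite expr0 mul1r; congr (_ ^+ _); apply: eq_card => x; rewrite !inE.
  by case: (x =P u) => [->|]; rewrite ?(negPf ltuv) ?andbF.
have -> : [set x in u |: F | (x < v)%N] = u |: [set x in F | (x < v)%N].
  by apply/setP=> x; rewrite !inE; case: (x =P u) => [->|] //=; rewrite ltuv.
by rewrite cardsU1 !inE (negPf uF) exprD.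
Qed.

(** Exterior multiplications by [e_u] and [e_v] anticommute. *)
Lemma ksign_swap v u F : v \notin F -> u \notin F -> v != u ->
  ksign v F * ksign u (v |: F) = - (ksign u F * ksign v (u |: F)).
Proof.
move=> vF uF; rewrite -val_eqE !ksignU //=.
by case: ltngtP => //= _ _; ring.
Qed.

Lemma ksignK v F : ksign v F * ksign v F = 1.
Proof. by rewrite /ksign -expr2 -exprM mulnC exprM sqrrN !expr1n. Qed.

(** Antisymmetry alone would only give that twice the sum is zero; matching the
    terms above the diagonal with those below it works in every
    characteristic. *)
Lemma sum_antisym (T : 'I_n -> 'I_n -> R) (P : pred 'I_n) :
  (forall v u, P v -> P u -> v != u -> T u v = - T v u) ->
  \sum_(v | P v) \sum_(u | P u && (u != v)) T v u = 0.
Proof.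
move=> antiT.
have split v : P v -> \sum_(u | P u && (u != v)) T v u =
    \sum_(u | P u && (u < v)%N) T v u + \sum_(u | P u && (v < u)%N) T v u.
  move=> Pv; rewrite (bigID (fun u : 'I_n => (u < v)%N)) /=.
  congr (_ + _); apply: eq_bigl => u; rewrite -val_eqE /=;
  by case: (P u) => //=; case: ltngtP.
rewrite (eq_bigr _ split) big_split /=.
rewrite (exchange_big_dep P) /= => [|v u _ /andP[]//].
rewrite -big_split big1 //= => v Pv.
rewrite (eq_bigl (fun u : 'I_n => P u && (v < u)%N)) => [|u]; last by rewrite Pv.
rewrite -big_split big1 //= => u /andP[Pu ltvu].
rewrite (antiT v u) ?addNr // -val_eqE /= ltn_eqF //.
Qed.

(** Removing [v] and then [u] cancels against removing [u] and then [v]. *)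
Lemma kdiff_kdiff y z F : kdiff y (kdiff y z) F = 0.
Proof.
pose T v u := ksign v F * y v * (ksign u (v |: F) * y u * z (u |: (v |: F))).
rewrite /kdiff -[RHS](@sum_antisym T (fun v => v \notin F)).
  apply: eq_bigr => v vF; rewrite big_distrr; apply: eq_bigl => u.
  by rewrite !inE negb_or andbC.
move=> v u vF uF vu; rewrite /T.
have := ksign_swap vF uF vu => e.
transitivity ((ksign u F * ksign v (u |: F)) * (y v * y u * z (v |: (u |: F)))).
  by ring.
by rewrite -[X in X * _]opprK -e setUCA; ring.
Qed.

Lemma eq_kdiff y z w : z =1 w -> kdiff y z =1 kdiff y w.
Proof. by move=> e F; apply: eq_bigr => v _; rewrite e. Qed.

Lemma kdiffZ y (f : R) z F : kdiff y (fun F => f * z F) F = f * kdiff y z F.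
Proof. by rewrite big_distrr; apply: eq_bigr => v _ /=; rewrite mulrCA. Qed.

Lemma kdiffB y z w F : kdiff y (fun F => z F - w F) F = kdiff y z F - kdiff y w F.
Proof. by rewrite -sumrB; apply: eq_bigr => v _; rewrite mulrBr. Qed.

Lemma kdiff_ideal y J z : is_ideal J -> (forall F, J (z F)) ->
  forall F, J (kdiff y z F).
Proof. by move=> idJ Jz F; apply: ideal_sum => // v _; apply: idealM. Qed.

Lemma khom_ideal v J z : is_ideal J -> (forall F, J (z F)) ->
  forall F, J (khom v z F).
Proof.
by move=> idJ Jz F; rewrite /khom; case: ifP => _; [apply: idealM|apply: ideal0].
Qed.

(** Multiplication by [y v] is null-homotopic.  This single identity gives both
    that [y v] kills Koszul homology and, when [y v = 1], that a cone over [v] is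
    acyclic. *)
Lemma homotopy y v z F :
  kdiff y (khom v z) F + khom v (kdiff y z) F = y v * z F.
Proof.
rewrite /khom; case: ifPn => vF; last first.
  rewrite addr0 /kdiff (bigD1 v) //= setU11 setU1K //.
  rewrite big1 ?addr0 => [|u /andP[_ uv]].
    by rewrite -[RHS]mul1r -(ksignK v F); ring.
  by rewrite !inE (negPf vF) orbF eq_sym (negPf uv) mulr0.
have vG : v \notin F :\ v by rewrite !inE eqxx.
have FE : F = v |: (F :\ v) by rewrite setD1K.
move: (F :\ v) vG FE => G vG FE.
rewrite /kdiff [X in ksign v G * X](bigD1 v) //= -FE mulrDr addrCA.
have -> : ksign v G * (ksign v G * y v * z F) = y v * z F.
  by rewrite -[RHS]mul1r -(ksignK v G); ring.
rewrite -[RHS]addr0; congr (_ + _).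
rewrite big_distrr /= [X in X + _](eq_bigl (fun u => (u \notin G) && (u != v))).
  rewrite -big_split big1 //= => u /andP[uG uv].
  have -> : v \in u |: F by rewrite FE !inE eqxx orbT.
  have -> : (u |: F) :\ v = u |: G.
    by rewrite FE setUCA setU1K // !inE negb_or eq_sym uv.
  have := ksign_swap uG vG uv; rewrite -FE => e.
  transitivity ((ksign u F * ksign v (u |: G) + ksign v G * ksign u G) * (y u * z (u |: G))).
    by ring.
  rewrite FE ksignU // ksignU // -[X in X * _](_ : 0 = _) ?mul0r //.
  have := uv; rewrite -val_eqE.
  by case: ltngtP => //= _ _; ring.
by move=> u; rewrite FE !inE negb_or andbC.
Qed.

Lemma khom_degree i v z : in_degree i z -> in_degree i.+1 (khom v z).
Proof.
move=> zi F; rewrite /khom; case: ifPn => [vF|_]; last by rewrite eqxx.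
move=> nz; rewrite (cardsD1 v) vF (zi (F :\ v)) //.
by apply: contraNneq nz => ->; rewrite mulr0.
Qed.

Lemma kdiff_degree i y z : in_degree i.+1 z -> in_degree i (kdiff y z).
Proof.
move=> zi F nz; case: (classic (exists2 v, v \notin F & z (v |: F) != 0)).
  by case=> v vF /zi; rewrite cardsU1 vF => -[].
move=> no; case/negP: nz; rewrite /kdiff big1 // => v vF.
have [->|nz] := eqVneq (z (v |: F)) 0; first by rewrite mulr0.
by case: no; exists v.
Qed.

Lemma in_degreeB i z w : in_degree i z -> in_degree i w ->
  in_degree i (fun F => z F - w F).
Proof.
move=> zi wi F; have [z0|/zi//] := eqVneq (z F) 0.
by rewrite z0 sub0r oppr_eq0 => /wi.
Qed.

Lemma in_degreeZ i f z : in_degree i z -> in_degree i (fun F => f * z F).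
Proof. by move=> zi F nz; apply: zi; apply: contraNneq nz => ->; rewrite mulr0. Qed.

Lemma in_degree_sum i (T : eqType) (s : seq T) (z : T -> {set 'I_n} -> R) :
  (forall t, t \in s -> in_degree i (z t)) ->
  in_degree i (fun F => \sum_(t <- s) z t F).
Proof.
move=> zi F nz; apply: NNPP => neq; case/negP: nz; apply/eqP.
rewrite big_seq big1 // => t /zi tz.
by have [//|/tz] := eqVneq (z t F) 0.
Qed.

Definition restrict_degree i z : {set 'I_n} -> R := fun F => if #|F| == i then z F else 0.

Lemma restrict_degreeP i z : in_degree i (restrict_degree i z).
Proof. by move=> F; rewrite /restrict_degree; case: ifP => [/eqP|]; rewrite ?eqxx. Qed.

End Koszul.

(** * Koszul homology and regular elements *)

Section KoszulHomology.
Variables (n : nat) (R : comNzRingType) (y : 'I_n -> R).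
Implicit Types (J : R -> Prop) (f g : R).

(** Vanishing of the Koszul homology [H_i(y; R/J)], with cycles and boundaries
    lifted to [R]. *)
Definition koszul_exact J i := forall z : {set 'I_n} -> R, in_degree i z ->
  (forall F, J (kdiff y z F)) ->
  exists w, in_degree i.+1 w /\ forall F, J (z F - kdiff y w F).

Lemma koszul_exact_ext J J' i : same_set J J' -> koszul_exact J i -> koszul_exact J' i.
Proof.
move=> JJ' ex z zi dz; case: (ex z zi) => [F|w [wi zw]]; first exact/JJ'.
by exists w; split=> // F; apply/JJ'.
Qed.

(** The part of the long exact sequence of
    [0 -> R/J -> R/J -> R/(J, f) -> 0] that bounds the homology of the quotient:
    for a cycle [z] modulo [(J, f)], write [dz = f t] modulo [J]; as [f] is
    regular, [t] is a cycle modulo [J], hence a boundary [du], and [z - f u] is a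
    cycle modulo [J]. *)
Lemma koszul_exact_add_elt J f i : is_ideal J -> nonzerodiv J f ->
  koszul_exact J i -> koszul_exact J i.+1 -> koszul_exact (add_elt J f) i.+1.
Proof.
move=> idJ nzf exi exi1 z zi dz.
have [t0 t0P] := choice _ dz.
(* the chosen coefficients are cut down to the degree in which they matter *)
pose t := restrict_degree i t0.
have tP F : J (kdiff y z F - f * t F).
  rewrite /t /restrict_degree; case: eqP => // neq; rewrite mulr0 subr0.
  have [->|/(kdiff_degree zi)//] := eqVneq (kdiff y z F) 0.
  exact: ideal0.
have dt F : J (kdiff y t F).
  apply: nzf; rewrite -kdiffZ -[X in J X]opprK; apply: idealN => //.
  rewrite -[X in J X]add0r -(kdiff_kdiff y z F) -kdiffB.
  exact: kdiff_ideal.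
have [u [ui tu]] := exi t (@restrict_degreeP _ _ _ _) dt.
have [|F|w [wi zw]] := exi1 (fun F => z F - f * u F).
- exact/in_degreeB/in_degreeZ.
- rewrite kdiffB kdiffZ.
  have -> : kdiff y z F - f * kdiff y u F =
    (kdiff y z F - f * t F) + f * (t F - kdiff y u F) by ring.
  by apply: idealD => //; apply: idealM.
exists w; split=> // F; exists (u F).
by rewrite addrAC.
Qed.

(** The elements that multiply the class of [z] to zero form an ideal, and the
    homotopy puts every [y v] in it. *)
Lemma irrelevant_kills_homology J f i (z : {set 'I_n} -> R) : is_ideal J ->
  in_degree i z -> (forall F, J (kdiff y z F)) ->
  ideal_gen (fun p => exists v, p = y v) f ->
  exists w, in_degree i.+1 w /\ forall F, J (f * z F - kdiff y w F).
Proof.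
move=> idJ zi dz; move: f; apply: ideal_gen_sub; last first.
  move=> _ [v ->]; exists (khom v z); split=> [|F]; first exact: khom_degree.
  by rewrite -(homotopy y v) addrAC subrr add0r; apply: khom_ideal.
split=> [|p q [w [wi pw]] [x [xi qx]]|r p [w [wi pw]]].
- exists (fun=> 0); split=> [F|F]; first by rewrite eqxx.
  rewrite mul0r /kdiff big1 ?subr0; first exact: ideal0.
  by move=> v _; rewrite mulr0.
- exists (fun F => w F - (-1) * x F).
  split=> [|F]; first exact/in_degreeB/in_degreeZ.
  rewrite kdiffB kdiffZ.
  rewrite (_ : _ - _ = (p * z F - kdiff y w F) + (q * z F - kdiff y x F)).
    exact: idealD.
  by ring.
- exists (fun F => r * w F); split=> [|F]; first exact: in_degreeZ.
  by rewrite kdiffZ -mulrA -mulrBr; apply: idealM.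
Qed.

(** Conversely a nonzero class of degree [i] survives as one of degree [i.+1]
    modulo [f]: if [f z = dw], then [w] is a cycle modulo [(J, f)], and if it
    bounds there, cancelling [f] shows that [z] was a boundary. *)
Lemma koszul_exact_of_add_elt J f i : is_ideal J -> nonzerodiv J f ->
  ideal_gen (fun p => exists v, p = y v) f ->
  koszul_exact (add_elt J f) i.+1 -> koszul_exact J i.
Proof.
move=> idJ nzf fm ex z zi dz.
have [w [wi fzw]] := irrelevant_kills_homology idJ zi dz fm.
have [F|u [ui wu]] := ex w wi.
  by exists (z F); rewrite -opprB; apply: idealN.
have [s0 s0P] := choice _ wu.
pose s := restrict_degree i.+1 s0.
have sP F : J (w F - kdiff y u F - f * s F).
  rewrite /s /restrict_degree; case: eqP => // neq; rewrite mulr0 subr0.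
  have [->|/wi//] := eqVneq (w F) 0.
  have [->|/(kdiff_degree ui)//] := eqVneq (kdiff y u F) 0.
  by rewrite subr0; apply: ideal0.
exists s; split=> [|F]; first exact: restrict_degreeP.
apply: nzf; rewrite mulrBr -kdiffZ.
rewrite (_ : _ - _ = (f * z F - kdiff y w F) +
    (kdiff y w F - kdiff y (kdiff y u) F - kdiff y (fun F => f * s F) F)).
  by apply: idealD => //; rewrite -!kdiffB; apply: kdiff_ideal.
by rewrite kdiff_kdiff; ring.
Qed.

(** The homology in top degree is the socle of [R/J]: a top chain is one element
    [g], its boundary has the coordinates [y v * g] up to sign, and no chain lies
    above it. *)
Lemma koszul_exact_top_socle J g : is_ideal J -> koszul_exact J n ->
  (forall v, J (y v * g)) -> J g.
Proof.
move=> idJ ex gm.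
have [||w [wi zw]] := ex (fun F => if F == setT then g else 0).
- by move=> F /=; case: (F =P setT) => [->|]; rewrite ?eqxx // cardsT card_ord.
- move=> F; apply: ideal_sum => // v _; rewrite -mulrA; apply: idealM => //.
  by case: eqP => // _; rewrite mulr0; apply: ideal0.
move: (zw setT); rewrite eqxx /kdiff big_pred0 ?subr0 // => v.
by rewrite inE.
Qed.

Lemma koszul_exact_gt J i : is_ideal J -> (n < i)%N -> koszul_exact J i.
Proof.
move=> idJ lti z zi _; exists (fun=> 0); split=> [F|F]; first by rewrite eqxx.
rewrite /kdiff big1 => [|v _]; last by rewrite mulr0.
rewrite subr0; have [->|/zi eqi] := eqVneq (z F) 0; first exact: ideal0.
by move: (max_card F) lti; rewrite card_ord eqi leqNgt => /negPf->.
Qed.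

(** In degree 0 the homology is [R/(J, y)]. *)
Lemma koszul_not_exact0 J : is_ideal J ->
  (forall p, J p -> ideal_gen (fun p => exists v, p = y v) p) ->
  ~ ideal_gen (fun p => exists v, p = y v) 1 -> ~ koszul_exact J 0.
Proof.
move=> idJ Jm m1 ex.
have idm := ideal_gen_is_ideal (fun p => exists v, p = y v).
have [||w [wi zw]] := ex (fun F => if F == set0 then 1 else 0).
- by move=> F /=; case: (F =P set0) => [->|]; rewrite ?eqxx // cards0.
- move=> F; rewrite /kdiff big1 => [|v _]; first exact: ideal0.
  rewrite (_ : (_ == _) = false) ?mulr0 //; apply/negbTE/set0Pn.
  by exists v; rewrite setU11.
move: (Jm _ (zw set0)); rewrite /= eqxx => mw.
apply: m1; apply: (ideal_congr idm mw).
apply: ideal_sum => // v _; rewrite mulrAC; apply: idealM => //.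
by apply: sub_ideal_gen; exists v.
Qed.

End KoszulHomology.

(** * Regular elements in Noetherian rings *)

Section Noetherian.
Variable R : comNzRingType.
Implicit Types (J m : R -> Prop) (f g p q : R).

(** The form of the Noetherian property in which the finitely many generators are
    taken among the given ones. *)
Definition noetherian := forall S : R -> Prop, exists T : seq R,
  (forall t, t \in T -> S t) /\ forall p, S p -> ideal_gen (fun q => q \in T) p.

Hypothesis noethR : noetherian.

(** Finitely many generators of the union of the chain all lie in one term. *)
Lemma noetherian_acc (J_ : nat -> R -> Prop) : (forall k, is_ideal (J_ k)) ->
  (forall k p, J_ k p -> J_ k.+1 p) -> exists N, forall p, J_ N.+1 p -> J_ N p.
Proof.
move=> idJ subS.
have mono k l p : (k <= l)%N -> J_ k p -> J_ l p.
  by move/subnK <-; elim: (l - k)%N => // d IH /IH; apply: subS.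
have [T [TU UT]] := noethR (fun p => exists k, J_ k p).
suff [N NT] : exists N, forall t, t \in T -> J_ N t.
  by exists N => p Jp; apply: (ideal_gen_sub (idJ N) NT); apply: UT; exists N.+1.
elim: T TU {UT} => [|t T IH] TU; first by exists 0%N.
have [|N NT] := IH; first by move=> u uT; apply: TU; rewrite inE uT orbT.
have [k kt] := TU t (mem_head _ _).
exists (maxn k N) => u; rewrite inE => /predU1P[->|/NT].
  by apply: mono kt; apply: leq_maxl.
by apply: mono; apply: leq_maxr.
Qed.

Variable J : R -> Prop.
Hypothesis idJ : is_ideal J.

(** Inclusion of the colon ideals [(J : g)] and [(J : g')]. *)
Definition colon_sub g g' := forall p, J (p * g) -> J (p * g').

(** The ideal [(J : g)] is a maximal associated prime of [J].  Associated primes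
    are represented by witnesses [g], so that no type of ideals is needed. *)
Definition maximal_colon g :=
  ~ J g /\ forall g', ~ J g' -> colon_sub g g' -> colon_sub g' g.

Lemma colon_is_ideal g : is_ideal (fun p => J (p * g)).
Proof.
split=> [|p q|r p].
- by rewrite mul0r; apply: ideal0.
- by rewrite mulrDl; apply: idealD.
- by rewrite -mulrA; apply: idealM.
Qed.

Lemma maximal_colon_above g : ~ J g -> exists2 g', maximal_colon g' & colon_sub g g'.
Proof.
move=> Jg; apply: NNPP => noMax.
pose X := {h | ~ J h /\ colon_sub g h}.
have step (h : X) : exists h' : X, colon_sub (sval h) (sval h') /\
    ~ colon_sub (sval h') (sval h).
  case: h => h [Jh gh] /=; apply: NNPP => no; apply: noMax; exists h => //.
  split=> // h' Jh' hh'; apply: NNPP => h'h; apply: no.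
  have gh' : colon_sub g h' by move=> p /gh /hh'.
  by exists (exist _ h' (conj Jh' gh')).
have [nxt nxtP] := choice _ step.
(* an ascending chain of colon ideals, built by repeating the step *)
pose x0 : X := exist _ g (conj Jg (fun p Jp => Jp)).
have [|k p /(proj1 (nxtP _))//|N stat] :=
  noetherian_acc (J_ := fun k p => J (p * sval (iter k nxt x0))).
  by move=> k; apply: colon_is_ideal.
by case: (nxtP (iter N nxt x0)) => _; apply.
Qed.

(** If [a] is not in [(J : g)], then [a * g] is again a witness, and by maximality
    it has the same colon ideal. *)
Lemma maximal_colon_prime g a b : maximal_colon g -> J (a * b * g) ->
  J (a * g) \/ J (b * g).
Proof.
case=> Jg maxg Jab; case: (classic (J (a * g))) => [|Jag]; [by left|right].
apply: (maxg _ Jag) => [p Jp|]; first by rewrite mulrCA; apply: idealM.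
by rewrite mulrA (mulrC b).
Qed.

(** The product of one element from each [(J : q)] outside the prime [(J : g)]. *)
Lemma maximal_colon_prod g (gs : seq R) : maximal_colon g ->
  (forall q, q \in gs -> ~ colon_sub q g) ->
  exists b, (forall q, q \in gs -> J (b * q)) /\ ~ J (b * g).
Proof.
move=> maxg; elim: gs => [|q gs IH] gsP.
  by exists 1; rewrite mul1r; split=> //; case: maxg.
have [|b [bgs bg]] := IH; first by move=> q' q'gs; apply: gsP; rewrite inE q'gs orbT.
have [a Ha] := not_all_ex_not _ _ (gsP q (mem_head _ _)).
have [aq ag] := imply_to_and _ _ Ha.
exists (a * b); split=> [q'|/(maximal_colon_prime maxg)[]//].
rewrite inE => /predU1P[->|/bgs]; first by rewrite mulrAC mulrC; apply: idealM.
by rewrite -mulrA; apply: idealM.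
Qed.

(** Choose finitely many witnesses that generate the ideal spanned by all of them.
    Any other witness is a combination of these, so its colon ideal contains the
    intersection of theirs, hence, being prime, contains one of them, and equals
    it by maximality. *)
Lemma finitely_many_maximal_colon : exists gs : seq R,
  (forall g, g \in gs -> maximal_colon g) /\
  forall g, maximal_colon g -> exists2 q, q \in gs & colon_sub g q.
Proof.
have [gs [gsmax gsgen]] := noethR maximal_colon; exists gs; split=> // g maxg.
apply: NNPP => no.
have [q qgs qg|b [bgs bg]] := maximal_colon_prod (gs := gs) maxg.
  apply: no; exists q => //.
  by case: (gsmax q qgs) => _; apply=> //; case: maxg.
apply: bg; apply: (ideal_gen_sub (J := fun p => J (b * p))) (gsgen g maxg) => //.
split=> [|p q|r p].
- by rewrite mulr0; apply: ideal0.
- by rewrite mulrDr; apply: idealD.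
- by rewrite mulrCA; apply: idealM.
Qed.

(** Prime avoidance.  If [f] avoids all the primes but [(J : g)], correct it by an
    element [h] of [m] that lies in all the others but not in [(J : g)]; such an
    [h] exists because distinct maximal colon ideals are incomparable. *)
Lemma maximal_colon_avoidance m (gs : seq R) : is_ideal m ->
  (forall g, g \in gs -> maximal_colon g) ->
  (forall g, g \in gs -> exists2 p, m p & ~ J (p * g)) ->
  exists2 f, m f & forall g, g \in gs -> ~ J (f * g).
Proof.
move=> idm; elim: gs => [|g gs IH] gsmax gsm.
  by exists 0 => //; apply: ideal0.
have gsS q : q \in gs -> q \in g :: gs by rewrite inE orbC => ->.
have [||f mf fgs] := IH; try by move=> q /gsS; auto.
have gg := mem_head g gs.
case: (classic (J (f * g))) => [Jfg|]; last first.
  by exists f => // q; rewrite inE => /predU1P[->|/fgs].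
have [q qgs qg|b [bgs bg]] := maximal_colon_prod (gs := gs) (gsmax g gg).
  apply: (fgs q) => //.
  by case: (gsmax q (gsS q qgs)) => _ /(_ g) H; apply: H => //; case: (gsmax g gg).
have [p mp pg] := gsm g gg.
have mh : m (b * p) by apply: idealM.
have hg : ~ J (b * p * g) by move/(maximal_colon_prime (gsmax g gg)) => [].
exists (f + b * p); first exact: idealD.
move=> q; rewrite inE => /predU1P[->|qgs] Jq.
  by apply: hg; rewrite -(addKr f (b * p)) mulrDl mulNr; apply: idealD => //; apply: idealN.
apply: (fgs q) => //; rewrite -(addrK (b * p) f) mulrBl; apply: idealB => //.
by rewrite mulrAC mulrC; apply: idealM => //; apply: bgs.
Qed.

(** If [m] kills no nonzero element of [R/J], then [m] is contained in no maximal
    associated prime, so it is not covered by the zero divisors of [R/J]. *)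
Lemma nonzerodiv_of_socle m : is_ideal m ->
  (forall g, (forall p, m p -> J (p * g)) -> J g) ->
  exists2 f, m f & nonzerodiv J f.
Proof.
move=> idm socle.
have [gs [gsmax gscover]] := finitely_many_maximal_colon.
have [//|//|g ggs|f mf fgs] := maximal_colon_avoidance (m := m) (gs := gs).
  apply: NNPP => no; case: (gsmax g ggs) => Jg _; apply/Jg/socle => p mp.
  by apply: NNPP => Jp; apply: no; exists p.
exists f => // g Jfg; apply: NNPP => Jg.
have [g' maxg' gg'] := maximal_colon_above Jg.
have [q qgs g'q] := gscover _ maxg'.
by apply: (fgs q qgs); apply/g'q/gg'.
Qed.

End Noetherian.

(** * Dickson's lemma and the Hilbert basis theorem *)

Section Dickson.
Variable n : nat.

Let dominated (k : nat) (T : seq 'X_{1..n}) (s : 'X_{1..n}) :=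
  exists2 t, t \in T & forall i : 'I_n, (i < k)%N -> (t i <= s i)%N.

Lemma dominated_cat k T T' s :
  dominated k T s \/ dominated k T' s -> dominated k (T ++ T') s.
Proof.
by case=> -[t tT ts]; exists t => //; rewrite mem_cat tT ?orbT.
Qed.

(** Dickson's lemma for divisibility tested on the first [k] exponents.  For one
    more variable [j], the finite set for [k] handles the monomials whose exponent
    at [j] is at least the largest one that occurs in it; the remaining ones fall
    into finitely many slices with constant exponent at [j], to which the
    statement for [k] applies again. *)
Lemma dickson_prefix k (S : 'X_{1..n} -> Prop) : exists T : seq 'X_{1..n},
  (forall t, t \in T -> S t) /\ forall s, S s -> dominated k T s.
Proof.
elim: k S => [|k IH] S.
  case: (classic (exists s, S s)) => [[t St]|no]; last first.
    by exists [::]; split=> // s Ss; case: no; exists s.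
  exists [:: t]; split=> [u|s _]; first by rewrite inE => /eqP->.
  by exists t; rewrite ?mem_head.
case: (leqP n k) => [lenk|ltkn].
  have [T [TS ST]] := IH S; exists T; split=> // s /ST[t tT ts].
  by exists t => // i _; apply: ts; apply: leq_trans (ltn_ord i) lenk.
pose j := Ordinal ltkn.
have slices M : exists T : seq 'X_{1..n}, (forall t, t \in T -> S t) /\
    forall s, S s -> (s j < M)%N -> dominated k.+1 T s.
  elim: M => [|M [T [TS ST]]]; first by exists [::].
  have [T' [T'S ST']] := IH (fun s => S s /\ s j = M).
  exists (T ++ T'); split=> [t|s Ss].
    by rewrite mem_cat => /orP[/TS|/T'S[]].
  rewrite ltnS leq_eqVlt => /orP[/eqP sj|ltsM]; apply: dominated_cat; last first.
    by left; apply: ST.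
  right; have [t tT ts] := ST' s (conj Ss sj); exists t => // i.
  rewrite ltnS leq_eqVlt => /orP[/eqP ik|/ts//].
  by rewrite (_ : i = j) ?sj ?(proj2 (T'S t tT)) //; apply: val_inj.
have [T [TS ST]] := IH S.
have [T' [T'S ST']] := slices (\max_(t <- T) t j).
exists (T ++ T'); split=> [t|s Ss]; first by rewrite mem_cat => /orP[/TS|/T'S].
apply: dominated_cat; case: (ltnP (s j) (\max_(t <- T) t j)) => [lts|les].
  by right; apply: ST'.
left; have [t tT ts] := ST s Ss; exists t => // i.
rewrite ltnS leq_eqVlt => /orP[/eqP ik|/ts//].
rewrite (_ : i = j); last exact: val_inj.
by apply: leq_trans les; apply: (@leq_bigmax_seq _ _ xpredT (fun t : 'X_{1..n} => t j)).
Qed.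

Lemma dickson (S : 'X_{1..n} -> Prop) : exists T : seq 'X_{1..n},
  (forall t, t \in T -> S t) /\ forall s, S s -> exists2 t, t \in T & (t <= s)%MM.
Proof.
have [T [TS ST]] := dickson_prefix n S; exists T; split=> // s /ST[t tT ts].
by exists t => //; apply/mnm_lepP => i; apply: ts.
Qed.

End Dickson.

Lemma ideal_gen_finite (R : comNzRingType) (S : R -> Prop) (P : seq R) :
  (forall p, p \in P -> ideal_gen S p) ->
  exists T : seq R, (forall t, t \in T -> S t) /\
    forall p, p \in P -> ideal_gen (fun q => q \in T) p.
Proof.
elim: P => [|p P IH] PS; first by exists [::].
have [|T [TS PT]] := IH; first by move=> q qP; apply: PS; rewrite inE qP orbT.
have [s [sS ->]] := PS p (mem_head _ _).
exists ([seq c.2 | c <- s] ++ T); split=> [t|q].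
  by rewrite mem_cat => /orP[/mapP[c cs ->]|/TS//]; apply: sS.
rewrite inE => /predU1P[->|/PT].
  exists s; split=> // c cs; rewrite mem_cat map_f //.
apply: ideal_gen_sub (ideal_gen_is_ideal _) _ _ => t tT.
by apply: sub_ideal_gen; rewrite mem_cat tT orbT.
Qed.

Section HilbertBasis.
Variables (K : fieldType) (n : nat).
Implicit Types (p q r : {mpoly K[n]}).

(** One step of division by a polynomial whose leading monomial divides that of
    [p]. *)
Lemma lead_reduction p q (c := p@_(mlead p) / q@_(mlead q))
  (r := p - c *: 'X_[mlead p - mlead q] * q) :
  p != 0 -> q != 0 -> (mlead q <= mlead p)%MM -> r != 0 -> (mlead r < mlead p)%O.
Proof.
move=> p0 q0 leqp r0.
have lq : q@_(mlead q) != 0 by rewrite mleadc_eq0.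
have c0 : c != 0 by rewrite mulf_neq0 ?invr_eq0 // mleadc_eq0.
have lm : mlead (c *: 'X_[mlead p - mlead q] * q) = mlead p.
  by rewrite -scalerAl mleadZ // mleadM -?msupp_eq0 ?msuppX // ?msupp_eq0 // mleadXm submK.
rewrite lt_neqAle; apply/andP; split; last first.
  by apply: le_trans (mleadB_le _ _) _; rewrite lm joinxx.
apply: contraNneq r0 => lr; rewrite -mleadc_eq0 lr /r mcoeffB.
have coefXM (m k : 'X_{1..n}) : (m + mlead q)%MM = k -> ('X_[m] * q)@_k = q@_(mlead q).
  by move=> <-; rewrite mulrC mcoeffMX.
rewrite -scalerAl mcoeffZ coefXM ?submK //.
by rewrite divfK // subrr.
Qed.

(** Polynomials of the ideal whose leading monomials dominate, in the sense of
    Dickson's lemma, those of the whole ideal generate it, by division along the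
    well-founded monomial order; each of them uses finitely many elements of
    [S]. *)
Lemma mpoly_noetherian : noetherian {mpoly K[n]}.
Proof.
move=> S; pose J := ideal_gen S; have idJ : is_ideal J := ideal_gen_is_ideal S.
have [M [MJ JM]] := dickson (fun m => exists2 p, J p & p != 0 /\ mlead p = m).
have [P [PJ PM]] : exists P : seq {mpoly K[n]}, (forall p, p \in P -> J p) /\
    forall m, m \in M -> exists2 p, p \in P & p != 0 /\ mlead p = m.
  elim: M MJ {JM} => [|m M IH] MJ; first by exists [::].
  have [|P [PJ PM]] := IH; first by move=> k kM; apply: MJ; rewrite inE kM orbT.
  have [p Jp pm] := MJ m (mem_head _ _).
  exists (p :: P); split=> [q|k]; first by rewrite inE => /predU1P[->|/PJ].
  rewrite inE => /predU1P[->|/PM[q qP qk]]; first by exists p; rewrite ?mem_head.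
  by exists q; rewrite // inE qP orbT.
suff JP : forall p, J p -> ideal_gen (fun q => q \in P) p.
  have [T [TS PT]] := ideal_gen_finite PJ; exists T; split=> // p Sp.
  apply: (ideal_gen_sub (ideal_gen_is_ideal _) PT).
  by apply/JP/sub_ideal_gen.
have idP := ideal_gen_is_ideal (fun q => q \in P).
suff wf m : forall p, mlead p = m -> J p -> ideal_gen (fun q => q \in P) p.
  by move=> p; apply: wf.
elim/(well_founded_ind (@ltom_wf n)): m => m IH p pm Jp.
have [->|p0] := eqVneq p 0; first exact: ideal0.
have [t tM tp] := JM (mlead p) (ex_intro2 _ _ p Jp (conj p0 erefl)).
have [q qP [q0 qt]] := PM t tM.
have leqp : (mlead q <= mlead p)%MM by rewrite qt.
have Pq : ideal_gen (fun q => q \in P) q by apply: sub_ideal_gen.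
have := lead_reduction p0 q0 leqp.
set r := p - _ => rp; have [r0|/rp ltr] := eqVneq r 0.
  apply: (ideal_congr idP (q := p - r)); last by rewrite /r opprB addrC subrK; apply: idealM.
  by rewrite opprB addrCA subrr addr0 r0; apply: ideal0.
apply: (ideal_congr idP (q := p - r)); last by rewrite /r opprB addrC subrK; apply: idealM.
rewrite opprB addrCA subrr addr0; apply: (IH (mlead r)) => //; first by rewrite -pm.
by apply: idealB => //; apply: idealM => //; apply: PJ.
Qed.

End HilbertBasis.

(** * Depth and Koszul homology *)

Section Depth.
Variables (K : fieldType) (n : nat).
Local Notation R := {mpoly K[n]}.
Implicit Types (I J : R -> Prop) (f : R) (fs : seq R).
Local Notation X := (fun v : 'I_n => 'X_v : R).

(** Regularity without properness, which is automatic inside the irrelevant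
    ideal. *)
Definition regular_steps I fs := forall i, (i < size fs)%N ->
  nonzerodiv (adjoin I (take i fs)) (fs`_i).

Lemma adjoin_nil I : is_ideal I -> same_set (adjoin I [::]) I.
Proof.
move=> idI p; split; last by move=> Ip; apply: sub_ideal_gen; left.
by apply: ideal_gen_sub => // q [].
Qed.

Lemma adjoin_is_ideal I fs : is_ideal (adjoin I fs).
Proof. exact: ideal_gen_is_ideal. Qed.

Lemma adjoin_rcons I fs f : same_set (adjoin I (rcons fs f)) (add_elt (adjoin I fs) f).
Proof.
have idA := adjoin_is_ideal I; have idF := add_elt_is_ideal f (idA fs).
move=> p; split.
  apply: ideal_gen_sub => // q [Iq|].
    by apply: sub_add_elt; apply: sub_ideal_gen; left.
  rewrite mem_rcons inE => /predU1P[->|qfs]; first exact: add_elt_self.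
  by apply: sub_add_elt; apply: sub_ideal_gen; right.
case=> r Ap; apply: (ideal_congr (idA _)) (_ : adjoin I (rcons fs f) (f * r)).
  apply: ideal_gen_sub (idA _) _ _ Ap => q [Iq|qfs]; apply: sub_ideal_gen; first by left.
  by right; rewrite mem_rcons inE qfs orbT.
rewrite mulrC; apply: idealM => //; apply: sub_ideal_gen; right.
by rewrite mem_rcons mem_head.
Qed.

Lemma regular_steps_rcons I fs f :
  regular_steps I (rcons fs f) <-> regular_steps I fs /\ nonzerodiv (adjoin I fs) f.
Proof.
split=> [reg|[reg nzf] i].
  split=> [i lti|]; last first.
    have := reg (size fs); rewrite size_rcons -cats1 take_size_cat //.
    by rewrite nth_cat ltnn subnn; apply.
  have := reg i; rewrite size_rcons ltnW // -cats1 take_cat lti nth_cat lti; apply.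
  by [].
rewrite size_rcons ltnS leq_eqVlt -cats1 => /orP[/eqP->|lti].
  by rewrite take_size_cat // nth_cat ltnn subnn.
by rewrite take_cat lti nth_cat lti; apply: reg.
Qed.

(** Every element of the irrelevant ideal has constant term 0. *)
Lemma irrelevant_1 : ~ @irrelevant K n 1.
Proof.
have idc : is_ideal (fun p : R => p@_0%MM = 0).
  split=> [|p q|r p]; first by rewrite mcoeff0.
    by rewrite mcoeffD => -> ->; rewrite addr0.
  by rewrite (mcoeff0_is_multiplicative n K).1 => ->; rewrite mulr0.
move/(ideal_gen_sub idc) => ev0; have /eqP : (1 : R)@_0%MM = 0.
  by apply: ev0 => _ [i ->]; rewrite mcoeffX mnm1_eq0.
by rewrite mcoeff1 eqxx oner_eq0.
Qed.

Lemma adjoin_sub_irrelevant I fs : (forall p, I p -> irrelevant p) ->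
  (forall f, f \in fs -> irrelevant f) -> forall p, adjoin I fs p -> irrelevant p.
Proof.
move=> Im fm; apply: ideal_gen_sub; first exact: ideal_gen_is_ideal.
by move=> p [/Im|/fm].
Qed.

(** A regular sequence of length [k] shifts nonzero Koszul homology up by [k];
    since there is none above degree [n], this bounds the length. *)
Lemma koszul_not_exact_adjoin I fs s : is_ideal I ->
  (forall f, f \in fs -> irrelevant f) -> regular_steps I fs ->
  ~ koszul_exact X I s -> ~ koszul_exact X (adjoin I fs) (s + size fs).
Proof.
move=> idI + + nex; elim/last_ind: fs => [|fs f IH] fm reg.
  rewrite addn0; apply: contra_not nex.
  exact/koszul_exact_ext/adjoin_nil.
have [regfs nzf] := proj1 (regular_steps_rcons _ _ _) reg.
move/(koszul_exact_ext (@adjoin_rcons _ _ _)); rewrite size_rcons addnS.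
have ff : irrelevant f by apply: fm; rewrite mem_rcons mem_head.
move/(koszul_exact_of_add_elt (adjoin_is_ideal _ _) nzf ff); apply: IH => //.
by move=> g gfs; apply: fm; rewrite mem_rcons inE gfs orbT.
Qed.

(** As long as the homology modulo the current sequence vanishes in top degree,
    the socle is zero and the sequence can be extended. *)
Lemma regular_steps_exist I s : is_ideal I ->
  (forall i, (s < i)%N -> koszul_exact X I i) ->
  forall k, (s + k <= n)%N -> exists fs, [/\ size fs = k,
    forall f, f \in fs -> irrelevant f, regular_steps I fs &
    forall i, (s + k < i)%N -> koszul_exact X (adjoin I fs) i].
Proof.
move=> idI ex; elim=> [|k IH] lek.
  exists [::]; split=> // i; rewrite addn0 => /ex; apply: koszul_exact_ext.
  by move=> p; split=> /adjoin_nil; apply.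
have [|fs [szfs fsm reg exfs]] := IH; first by apply: leq_trans lek; rewrite leq_add2l.
have idA := adjoin_is_ideal I fs.
have [|g gm|f fm nzf] :=
  nonzerodiv_of_socle (@mpoly_noetherian K n) idA (m := @irrelevant K n).
- exact: ideal_gen_is_ideal.
- apply: (koszul_exact_top_socle idA (exfs n _)); first by rewrite -addnS.
  by move=> v; apply: gm; apply: sub_ideal_gen; exists v.
exists (rcons fs f); split=> [|g||i].
- by rewrite size_rcons szfs.
- by rewrite mem_rcons inE => /predU1P[->|/fsm].
- exact/regular_steps_rcons.
rewrite addnS; case: i => // i; rewrite ltnS => lti.
apply: (koszul_exact_ext (J := add_elt (adjoin I fs) f)).
  by move=> p; split=> /adjoin_rcons.
by apply: koszul_exact_add_elt => //; apply: exfs => //; apply: leqW.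
Qed.

(** Depth sensitivity of the Koszul complex. *)
Lemma depth_koszul I s : is_ideal I -> (forall p, I p -> irrelevant p) ->
  ~ koszul_exact X I s -> (forall i, (s < i)%N -> koszul_exact X I i) ->
  depth_quotient_is I (n - s).
Proof.
move=> idI Im nex ex.
have bound t fs : (forall f, f \in fs -> irrelevant f) -> regular_steps I fs ->
    ~ koszul_exact X I t -> (t + size fs <= n)%N.
  move=> fm reg next; rewrite leqNgt; apply/negP => lt.
  apply: (koszul_not_exact_adjoin idI fm reg next).
  exact: koszul_exact_gt (adjoin_is_ideal _ _) lt.
have lesn : (s <= n)%N by rewrite -(addn0 s); apply: (bound s [::]).
split=> [|fs [fm [reg _]]]; last by rewrite leq_subRL //; apply: bound.
have [|fs [szfs fm reg _]] := regular_steps_exist idI ex (k := n - s).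
  by rewrite subnKC.
exists fs; split=> //; split=> //; split=> //.
by move/(adjoin_sub_irrelevant Im fm); apply: irrelevant_1.
Qed.

Lemma last_koszul_homology I : is_ideal I -> (forall p, I p -> irrelevant p) ->
  exists2 s, ~ koszul_exact X I s & forall i, (s < i)%N -> koszul_exact X I i.
Proof.
move=> idI Im.
have nex0 : ~ koszul_exact X I 0 := koszul_not_exact0 idI Im irrelevant_1.
suff last k : (forall i, (k < i)%N -> koszul_exact X I i) ->
    exists2 s, ~ koszul_exact X I s & forall i, (s < i)%N -> koszul_exact X I i.
  by apply: (last n) => i; apply: koszul_exact_gt.
elim: k => [|k IH] ex; first by exists 0%N.
case: (classic (koszul_exact X I k.+1)) => [exk|]; last by exists k.+1.
by apply: IH => i; rewrite leq_eqVlt => /predU1P[<-|/ex].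
Qed.

(** Degree 0 is left out of the hypothesis because the homology there is the base
    field for both ideals. *)
Lemma depth_eq_of_koszul I J : is_ideal I -> (forall p, I p -> irrelevant p) ->
  is_ideal J -> (forall p, J p -> irrelevant p) ->
  (forall i, koszul_exact X I i.+1 <-> koszul_exact X J i.+1) ->
  exists d, depth_quotient_is I d /\ depth_quotient_is J d.
Proof.
move=> idI Im idJ Jm IJ.
have [s nex ex] := last_koszul_homology idI Im.
exists (n - s)%N; split; first exact: depth_koszul.
apply: depth_koszul => // [|[|i] //]; last by move/ex/IJ.
by case: s nex {ex} => [_|s nex]; [apply: koszul_not_exact0 Jm irrelevant_1|move/IJ].
Qed.

End Depth.

(** * Multigraded Koszul homology of monomial ideals *)

Section MonomialIdeals.
Variables (K : fieldType) (n : nat).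
Local Notation R := {mpoly K[n]}.
Implicit Types (S : 'X_{1..n} -> Prop) (a b m s : 'X_{1..n}) (p q r : R).
Implicit Types (F : {set 'I_n}) (c u : {set 'I_n} -> K) (z w : {set 'I_n} -> R).
Implicit Types (D : {set 'I_n} -> Prop).
Local Notation X := (fun v : 'I_n => 'X_v : R).
Local Notation ones := (fun _ : 'I_n => 1 : K).

Lemma monomial_genP S p :
  monomial_gen S p <-> forall m, m \in msupp p -> exists2 s, S s & (s <= m)%MM.
Proof.
split=> [|Sp].
  move: p; apply: ideal_gen_sub; last first.
    by move=> _ [s Ss ->] m; rewrite msuppX inE => /eqP->; exists s => //; apply: lepm_refl.
  split=> [m|p q Sp Sq m|r p Sp m]; first by rewrite msupp0.
    by move/msuppD_le; rewrite mem_cat => /orP[/Sp|/Sq].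
  move/msuppM_le => /allpairsP[[k l] /= [_ /Sp[s Ss sl] ->]].
  by exists s => //; apply: lepm_trans sl (lem_addl _ _).
have idS := ideal_gen_is_ideal (fun p : R => exists2 m, S m & p = 'X_[m]).
rewrite (mpolyE p) /monomial_gen big_seq; apply: ideal_sum => // m /Sp[s Ss sm].
rewrite -mul_mpolyC; apply: idealM => //; rewrite -(submK sm) mpolyXD.
by apply: idealM => //; apply: sub_ideal_gen; exists s.
Qed.

Lemma monomial_gen_irrelevant S : (forall s, S s -> s != 0%MM) ->
  forall p, @monomial_gen K n S p -> irrelevant p.
Proof.
move=> S0; apply: ideal_gen_sub; first exact: ideal_gen_is_ideal.
move=> _ [s /S0 s0 ->].
have [i si] : exists i, s i != 0%N.
  apply: NNPP => no; case/eqP: s0; apply/mnmP => i; rewrite mnm0E.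
  by apply/eqP/negPn/negP => si; apply: no; exists i.
rewrite -lep1mP in si; rewrite -(submK si) mpolyXD.
by apply: idealM; [apply: ideal_gen_is_ideal|apply: sub_ideal_gen; exists i].
Qed.

Definition mnm_set F : 'X_{1..n} := [multinom (i \in F : nat) | i < n].

Lemma mnm_setE F i : mnm_set F i = (i \in F).
Proof. exact: mnmE. Qed.

Lemma mnm_setU1 v F : v \notin F -> mnm_set (v |: F) = (U_(v) + mnm_set F)%MM.
Proof.
move=> vF; apply/mnmP => i; rewrite mnmDE mnm1E !mnm_setE !inE eq_sym.
by case: (v =P i) => [<-|] //; rewrite (negPf vF).
Qed.

Lemma mnm_setU1_le v F a : v \notin F ->
  (mnm_set (v |: F) <= a)%MM = (a v != 0%N) && (mnm_set F <= a)%MM.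
Proof.
move=> vF; rewrite mnm_setU1 //; apply/mnm_lepP/andP => [le|[av /mnm_lepP le] i].
  split; first by move: (le v); rewrite mnmDE mnm1E eqxx; case: (a v).
  by apply/mnm_lepP => i; apply: leq_trans (le i); rewrite mnmDE leq_addl.
rewrite mnmDE mnm1E; case: (v =P i) => [<-|_]; last exact: le.
by rewrite mnm_setE (negPf vF) lt0n.
Qed.

(** The faces [F] for which [x^(a - F)] lies in the monomial ideal spanned by [S];
    this is the upper Koszul simplicial complex of the ideal in degree [a]. *)
Definition upper_koszul S a : {set 'I_n} -> Prop :=
  fun F => exists2 s, S s & (s + mnm_set F <= a)%MM.

Lemma upper_koszul_le S a F : upper_koszul S a F -> (mnm_set F <= a)%MM.
Proof. by case=> s _; apply: lepm_trans; apply: lem_addl. Qed.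

(** In the multigraded Koszul complex [e_F] has the degree of the product of the
    variables in [F], so the component of degree [a] of a chain has at [F] the
    coefficient of [x^(a - F)], and nothing when this is not a monomial. *)
Definition graded_part a z : {set 'I_n} -> K := fun F =>
  if (mnm_set F <= a)%MM then (z F)@_(a - mnm_set F) else 0.

Definition monomial_chain a c : {set 'I_n} -> R := fun F =>
  c F *: 'X_[a - mnm_set F].

Lemma mcoeffXM v p m :
  ('X_v * p)@_m = if m v == 0%N then 0 else p@_(m - U_(v)).
Proof.
case: ifPn => [/eqP mv|]; last first.
  by rewrite -lep1mP => /submK e; rewrite -{1}e mulrC addmC mcoeffMX.
apply/eqP; rewrite mcoeff_eq0; apply/negP => /msuppM_le /allpairsP[[k l] /=].
rewrite msuppX inE => -[/eqP-> _ e].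
by move: mv; rewrite e mnmDE mnm1E eqxx.
Qed.

(** The differential has multidegree 0, and on each component it is the boundary
    of a simplex with coefficients in the field. *)
Lemma graded_part_kdiff a z F :
  graded_part a (kdiff X z) F = kdiff ones (graded_part a z) F.
Proof.
rewrite /graded_part; case: ifPn => leF; last first.
  by rewrite /kdiff big1 // => v vF; rewrite mnm_setU1_le // (negPf leF) andbF mulr0.
rewrite /kdiff raddf_sum /=; apply: eq_bigr => v vF.
have -> : ksign {mpoly K[n]} v F = (ksign K v F)%:MP.
  by rewrite /ksign rmorphXn /= rmorphN1.
rewrite -mulrA mcoeffCM mulr1 mcoeffXM mnm_setU1_le // leF andbT.
rewrite mnmBE mnm_setE (negPf vF) subn0; case: eqP => //= _.
by rewrite mnm_setU1 // [(U_(v) + _)%MM]addmC submDA.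
Qed.

Lemma graded_partB a z w F :
  graded_part a (fun F => z F - w F) F = graded_part a z F - graded_part a w F.
Proof. by rewrite /graded_part; case: ifP; rewrite ?subr0 // mcoeffB. Qed.

Lemma graded_part_sum a (T : Type) (t : seq T) (zs : T -> {set 'I_n} -> R) F :
  graded_part a (fun F => \sum_(x <- t) zs x F) F = \sum_(x <- t) graded_part a (zs x) F.
Proof.
rewrite /graded_part; case: ifP => _; last by rewrite big1.
by rewrite raddf_sum.
Qed.

Lemma graded_part_degree i a z : in_degree i z -> in_degree i (graded_part a z).
Proof.
move=> zi F; rewrite /graded_part; case: ifP => _; last by rewrite eqxx.
by move=> nz; apply: zi; apply: contraNneq nz => ->; rewrite mcoeff0.
Qed.

Lemma monomial_chain_degree i a c : in_degree i c -> in_degree i (monomial_chain a c).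
Proof.
move=> ci F nz; apply: ci; apply: contraNneq nz => c0.
by rewrite /monomial_chain c0 scale0r.
Qed.

Lemma graded_part_monomial a b c F : (forall F, c F != 0 -> (mnm_set F <= a)%MM) ->
  graded_part b (monomial_chain a c) F = if b == a then c F else 0.
Proof.
move=> ca; rewrite /graded_part /monomial_chain mcoeffZ mcoeffX.
have [->|/ca lea] := eqVneq (c F) 0; first by rewrite mul0r !if_same.
case: (b =P a) => [->|neq]; first by rewrite lea eqxx mulr1.
case: ifP => // leb; case: eqP => [e|]; last by rewrite mulr0.
by case: neq; rewrite -(submK lea) -(submK leb) e.
Qed.

(** A monomial ideal is the sum of its graded components. *)
Lemma monomial_genP_graded S z : (forall F, monomial_gen S (z F)) <->
  forall a F, graded_part a z F != 0 -> upper_koszul S a F.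
Proof.
split=> [Sz a F|Sz F].
  rewrite /graded_part; case: ifP => [leF|]; last by rewrite eqxx.
  rewrite -mcoeff_msupp => /(proj1 (monomial_genP S _) (Sz F))[s Ss sle].
  exists s => //; rewrite -(submK leF); apply/mnm_lepP => i; rewrite !mnmDE leq_add2r.
  exact/(mnm_lepP _).
apply/monomial_genP => m; rewrite mcoeff_msupp => nz.
have [|s Ss sle] := Sz (m + mnm_set F)%MM F.
  by rewrite /graded_part lem_addl addmK.
exists s => //; apply/mnm_lepP => i; move/mnm_lepP/(_ i): sle.
by rewrite !mnmDE leq_add2r.
Qed.

(** Vanishing of the homology carried by the faces in [D] with [i] elements, that
    is of the reduced homology in dimension [i - 1]. *)
Definition acyclic D i := forall c, in_degree i c -> (forall F, c F != 0 -> D F) ->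
  (forall F, kdiff ones c F = 0) ->
  exists u, [/\ in_degree i.+1 u, forall F, u F != 0 -> D F &
    forall F, c F = kdiff ones u F].

Lemma kdiff_khom_cycle v c : (forall F, kdiff ones c F = 0) ->
  forall F, kdiff ones (khom v c) F = c F.
Proof.
move=> dc F; have := homotopy ones v c F.
by rewrite {2}/khom dc mulr0 if_same addr0 mul1r.
Qed.

(** Adjoining [v] to the faces that carry a chain. *)
Lemma khom_support v c D D' : (forall F, c F != 0 -> D F) ->
  (forall F, v \notin F -> D F -> D' (v |: F)) -> forall F, khom v c F != 0 -> D' F.
Proof.
move=> cD DD' F; rewrite /khom; case: ifPn => [vF nz|]; last by rewrite eqxx.
rewrite -(setD1K vF); apply: DD'; first by rewrite !inE eqxx.
by apply: cD; apply: contraNneq nz => ->; rewrite mulr0.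
Qed.

Lemma acyclic_cone D v i : (forall F, v \notin F -> D F -> D (v |: F)) -> acyclic D i.
Proof.
move=> cone c ci cD dc; exists (khom v c); split.
- exact: khom_degree.
- exact: khom_support cD cone.
- by move=> F; rewrite kdiff_khom_cycle.
Qed.

Lemma acyclic_ext D D' i : same_set D D' -> acyclic D i -> acyclic D' i.
Proof.
move=> DD' ac c ci cD dc; have [|u [ui uD cu]] := ac c ci _ dc.
  by move=> F /cD /DD'.
by exists u; split=> // F /uD /DD'.
Qed.

(** Degree [a] of the connecting isomorphism [H_(i+1)(R/J) = H_i(J)].  A cycle [c]
    on the upper Koszul complex bounds the cone [c1] over it in the full simplex on
    the support of [a], which is nonempty because 1 is not in [J]; [c1] is a
    cycle modulo [J], and the exactness there corrects it to a chain carried by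
    [J]. *)
Lemma acyclic_of_koszul_exact S a i : (forall s, S s -> s != 0%MM) ->
  koszul_exact X (monomial_gen S) i.+1 -> acyclic (upper_koszul S a) i.
Proof.
move=> S0 ex c ci cS dc.
case: (classic (exists F, c F != 0)) => [[F0 cF0]|c0]; last first.
  have {}c0 F : c F = 0 by apply/eqP/negPn/negP => cF; apply: c0; exists F.
  exists (fun=> 0); split=> [F|F|F]; rewrite ?eqxx // c0 /kdiff big1 // => v _.
  by rewrite mulr0.
have [v av] : exists v, a v != 0%N.
  have [s /S0 s0 sle] := cS F0 cF0; apply: NNPP => no; case/eqP: s0; apply/mnmP => v.
  have /eqP av0 : a v == 0%N by apply/negPn/negP => av; apply: no; exists v.
  move/mnm_lepP/(_ v): sle; rewrite mnmDE av0 leqn0 addn_eq0 => /andP[/eqP-> _].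
  by rewrite mnm0E.
pose c1 := khom v c.
have dc1 F : kdiff ones c1 F = c F by apply: kdiff_khom_cycle.
have c1a : forall F, c1 F != 0 -> (mnm_set F <= a)%MM.
  apply: (khom_support (D := fun F => (mnm_set F <= a)%MM)).
    by move=> F /cS /upper_koszul_le.
  by move=> F vF leF; rewrite mnm_setU1_le // av.
have [||w [wi zw]] := ex (monomial_chain a c1).
- exact/monomial_chain_degree/khom_degree.
- apply/monomial_genP_graded => b F; rewrite graded_part_kdiff.
  rewrite (eq_kdiff _ (w := fun F => (b == a)%:R * c1 F)) => [|G]; last first.
    by rewrite graded_part_monomial //; case: eqP; rewrite ?mul1r ?mul0r.
  rewrite kdiffZ dc1; case: (b =P a) => [->|_]; last by rewrite mul0r eqxx.
  by rewrite mul1r; apply: cS.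
exists (fun F => c1 F - kdiff ones (graded_part a w) F); split.
- exact/in_degreeB/kdiff_degree/graded_part_degree/wi/khom_degree.
- move=> F nz; apply: (proj1 (monomial_genP_graded S _) zw).
  by rewrite graded_partB graded_part_kdiff graded_part_monomial // eqxx.
- by move=> F; rewrite kdiffB kdiff_kdiff subr0 dc1.
Qed.

(** The other direction in a single degree [a]: the boundary of the component of
    [z] bounds a chain [u] carried by the complex, and their difference is a cycle
    of positive degree of the full simplex on the support of [a], hence bounds. *)
Lemma bound_graded_part S a z i : acyclic (upper_koszul S a) i ->
  in_degree i.+1 z -> (forall F, monomial_gen S (kdiff X z F)) ->
  exists w : {set 'I_n} -> K, [/\ in_degree i.+2 w, forall F, w F != 0 -> (mnm_set F <= a)%MM &
    forall F, graded_part a z F - kdiff ones w F != 0 -> upper_koszul S a F].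
Proof.
move=> ac zi dz; set c := graded_part a z.
have ci : in_degree i.+1 c by apply: graded_part_degree.
have [||F|u [ui uS cu]] := ac (kdiff ones c).
- exact: kdiff_degree.
- by move=> F; rewrite -graded_part_kdiff; apply: (proj1 (monomial_genP_graded S _) dz).
- exact: kdiff_kdiff.
(* the difference is a cycle of the full simplex *)
pose e F := c F - u F.
have ei : in_degree i.+1 e by apply: in_degreeB.
have de F : kdiff ones e F = 0 by rewrite kdiffB cu subrr.
have ea F : e F != 0 -> (mnm_set F <= a)%MM.
  have [u0|/uS /upper_koszul_le//] := eqVneq (u F) 0.
  by rewrite /e u0 subr0 /c /graded_part; case: ifP; rewrite ?eqxx.
case: (classic (exists F, e F != 0)) => [[F0 eF0]|e0]; last first.
  have {}e0 F : c F = u F.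
    apply/eqP; rewrite -subr_eq0; apply/negPn/negP => eF; apply: e0; exists F.
    exact: eF.
  exists (fun=> 0); split=> [F|F|F]; rewrite ?eqxx // /kdiff big1 ?subr0 => [|v _].
    by rewrite e0; apply: uS.
  by rewrite mulr0.
have [v vF0] : exists v, v \in F0 by apply/set0Pn; rewrite -cards_eq0 (ei F0).
have av : a v != 0%N.
  by move/mnm_lepP/(_ v): (ea _ eF0); rewrite mnm_setE vF0 lt0n.
exists (khom v e); split; first exact: khom_degree.
  by apply: khom_support ea _ => F vF leF; rewrite mnm_setU1_le // av.
move=> F; rewrite kdiff_khom_cycle // /e subKr; exact: uS.
Qed.

(** Only finitely many degrees occur in a chain, so the chains found in each of
    them can be added up. *)
Lemma koszul_exact_of_acyclic S i :
  (forall a, acyclic (upper_koszul S a) i) -> koszul_exact X (monomial_gen S) i.+1.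
Proof.
move=> ac z zi dz.
have bound a := bound_graded_part (ac a) zi dz.
have [ws wsP] := choice _ bound.
pose degs := undup [seq (m + mnm_set F)%MM | F <- enum {set 'I_n}, m <- msupp (z F)].
pose w F := \sum_(a <- degs) monomial_chain a (ws a) F.
exists w; split.
  by apply: in_degree_sum => a _; apply: monomial_chain_degree; case: (wsP a).
apply/monomial_genP_graded => a F.
have wa G : graded_part a w G = if a \in degs then ws a G else 0.
  rewrite graded_part_sum (eq_bigr (fun b => if a == b then ws b G else 0)).
    rewrite -big_mkcond /=; case: ifPn => [ad|nad].
      rewrite (big_rem a) //= eqxx big_seq_cond big1 ?addr0 // => b.
      rewrite mem_rem_uniq ?undup_uniq // !inE => /andP[/andP[/negPf ba _]].
      by rewrite eq_sym ba.
    rewrite big_seq_cond big1 // => b /andP[bd /eqP ab].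
    by rewrite -ab (negPf nad) in bd.
  by move=> b _; rewrite graded_part_monomial //; case: (wsP b).
rewrite graded_partB graded_part_kdiff (eq_kdiff _ wa).
case: (boolP (a \in degs)) => [_|nad]; first by case: (wsP a) => _ _; apply.
have -> : graded_part a z F = 0.
  rewrite /graded_part; case: ifP => // leF; apply/eqP; rewrite mcoeff_eq0.
  apply: contra nad => ms; rewrite mem_undup; apply/allpairsPdep.
  by exists F, (a - mnm_set F)%MM; rewrite mem_enum submK.
by rewrite /kdiff big1 ?subrr ?eqxx // => v _; rewrite mulr0.
Qed.

End MonomialIdeals.

(** * Order patterns of exponents *)

Section SameOrderPattern.
Variables (K : fieldType) (n q : nat).

(** If some [b v] is not an entry of row [v] of [B], then lowering the exponent of
    [x_v] by one never leaves the ideal, so the complex in degree [b] is a cone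
    with apex [v].  Otherwise [b] picks an entry in each row, and the
    corresponding entries of [A] give a degree with exactly the same complex. *)
Lemma acyclic_same_pattern (A B : 'M[nat]_(n, q)) i :
  (forall r j k, (A r j <= A r k)%N = (B r j <= B r k)%N) ->
  (forall a, @acyclic K n (upper_koszul (columns_in A setT) a) i) ->
  forall b, @acyclic K n (upper_koszul (columns_in B setT) b) i.
Proof.
move=> AB acA b.
have facet (C : 'M[nat]_(n, q)) a F : upper_koszul (columns_in C setT) a F <->
    exists j, forall r, (C r j + (r \in F) <= a r)%N.
  split=> [[_ [j _ ->] /mnm_lepP le]|[j le]].
    by exists j => r; move: (le r); rewrite mnmDE mnmE mnm_setE.
  exists (column C j); first by exists j.
  by apply/mnm_lepP => r; rewrite mnmDE mnmE mnm_setE.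
case: (classic (forall r, exists j, b r = B r j)) => [/(choice _)[js bjs]|].
  apply: acyclic_ext (acA [multinom A r (js r) | r < n]) => F.
  have eqAB r j (t : bool) : (A r j + t <= A r (js r))%N = (B r j + t <= B r (js r))%N.
    by case: t; rewrite ?addn0 ?addn1 ?AB // ltnNge [in RHS]ltnNge AB.
  split=> /facet[j le]; apply/facet; exists j => r; move: (le r);
  by rewrite mnmE ?bjs eqAB.
move/not_all_ex_not => [v nbv]; apply: (acyclic_cone (v := v)) => F vF /facet[j le].
apply/facet; exists j => r; rewrite !inE; case: (r =P v) => [->|_]; last exact: le.
(* adding 1 to the exponent is harmless because equality is excluded *)
rewrite addn1 ltn_neqAle; apply/andP; split; last exact: leq_trans (leq_addr _ _) (le v).
by apply/eqP => e; apply: nbv; exists j.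
Qed.

End SameOrderPattern.

(** * Incidence matrices and signatures *)

Section IncidenceMatrix.
Variables (K : fieldType) (n : nat).
Local Notation R := {mpoly K[n]}.
Implicit Types (I : R -> Prop) (S T : 'X_{1..n} -> Prop).

Lemma monomial_genX S m : @monomial_gen K n S 'X_[m] -> exists2 s, S s & (s <= m)%MM.
Proof. by move/monomial_genP; apply; rewrite msuppX mem_head. Qed.

Lemma monomial_gen_sub S T : (forall s, S s -> exists2 t, T t & (t <= s)%MM) ->
  forall p : R, monomial_gen S p -> monomial_gen T p.
Proof.
move=> ST p /monomial_genP Sp; apply/monomial_genP => m /Sp[s /ST[t Tt ts] sm].
by exists t => //; apply: lepm_trans sm.
Qed.

Lemma monomial_gen_ext S T : same_set S T -> @same_set R (monomial_gen S) (monomial_gen T).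
Proof.
by move=> ST p; split; apply: monomial_gen_sub => s /ST; exists s => //; apply: lepm_refl.
Qed.

(** Superfluous columns are dropped until none is left. *)
Lemma incidence_matrix_of_columns q (A : 'M[nat]_(n, q)) I :
  same_set I (monomial_gen (columns_in A setT)) ->
  exists (q' : nat) (A' : 'M[nat]_(n, q')), incidence_matrix I A'.
Proof.
elim/ltn_ind: q A => q IH A IA.
case: (classic (exists2 J : {set 'I_q}, J \proper setT &
                  same_set I (monomial_gen (columns_in A J)))) => [[J ltJ IJ]|no]; last first.
  by exists q, A; split=> // J ltJ IJ; apply: no; exists J.
apply: (IH #|J| _ (\matrix_(i < n, j < #|J|) A i (enum_val j))).
  by move: (proper_card ltJ); rewrite cardsT card_ord.
move=> p; apply: (iff_trans (IJ p)); apply: monomial_gen_ext => m.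
have colE (k : 'I_(#|J|)) :
    column (\matrix_(i, j) A i (enum_val j)) k = column A (enum_val k).
  by apply/mnmP => i; rewrite !mnmE mxE.
split=> [[j jJ ->]|[k _ ->]]; last by exists (enum_val k); rewrite ?enum_valP.
by exists (enum_rank_in jJ j); rewrite ?inE // colE enum_rankK_in.
Qed.

Lemma incidence_matrix_exists I : monomial_ideal I ->
  exists (q : nat) (A : 'M[nat]_(n, q)), incidence_matrix I A.
Proof.
case=> S IS; have [T [TS ST]] := dickson S.
apply: (@incidence_matrix_of_columns (size T) (\matrix_(i, j) nth 0%MM T j i)) => p.
have colE j : column (\matrix_(i < n, j < size T) nth 0%MM T j i) j = nth 0%MM T j.
  by apply/mnmP => i; rewrite mnmE mxE.
apply: (iff_trans (IS p)); split; apply: monomial_gen_sub => s.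
  case/ST=> t tT ts; exists t => //.
  have ltt : (index t T < size T)%N by rewrite index_mem.
  by exists (Ordinal ltt); rewrite ?inE // colE nth_index.
case=> j _ ->; exists (nth 0%MM T j); last by rewrite colE lepm_refl.
exact/TS/mem_nth.
Qed.

Section Columns.
Variables (I : R -> Prop) (q : nat) (A : 'M[nat]_(n, q)).
Hypothesis incA : incidence_matrix I A.

Lemma column_mem j : I 'X_[column A j].
Proof. by apply/(proj1 incA)/sub_ideal_gen; exists (column A j) => //; exists j. Qed.

Lemma column_below m : I 'X_[m] -> exists j, (column A j <= m)%MM.
Proof. by move/(proj1 incA)/monomial_genX => [_ [j _ ->] le]; exists j. Qed.

(** Otherwise column [j] is superfluous. *)
Lemma column_minimal j l : (column A l <= column A j)%MM -> l = j.
Proof.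
move=> le; apply: NNPP => lj; apply: (proj2 incA [set~ j]).
  by rewrite properEneq subsetT andbT; apply/eqP => /setP/(_ j); rewrite !inE eqxx.
move=> p; apply: (iff_trans (proj1 incA p)).
split; apply: monomial_gen_sub => _ [k kJ ->]; last first.
  by exists (column A k); [exists k|apply: lepm_refl].
have [->|kj] := eqVneq k j.
  by exists (column A l) => //; exists l => //; rewrite !inE; apply/eqP.
by exists (column A k); [exists k; rewrite ?inE|apply: lepm_refl].
Qed.

Lemma principal_of_least_column j :
  (forall k, (column A j <= column A k)%MM) -> principal I.
Proof.
move=> least; exists 'X_[column A j] => p.
have idg := ideal_gen_is_ideal (fun p => p = 'X_[column A j] :> R).
split=> [/(proj1 incA)|]; last first.
  move=> gp; apply/(proj1 incA); apply: ideal_gen_sub (ideal_gen_is_ideal _) _ _ gp.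
  by move=> _ ->; apply/(proj1 incA)/column_mem.
apply: (ideal_gen_sub idg) => _ [_ [k _ ->] ->].
by rewrite -(submK (least k)) mpolyXD; apply: idealM => //; apply: sub_ideal_gen.
Qed.

(** The signature of a row lists the ranks of its entries, so it has the same order
    pattern. *)
Lemma sgn_mx_le i j k : (sgn_mx A i j <= sgn_mx A i k)%N = (A i j <= A i k)%N.
Proof.
rewrite !mxE; set s := sort _ _.
have srt : sorted leq s by apply: sort_sorted; apply: leq_total.
have ms l : A i l \in s by rewrite mem_sort mem_undup codom_f.
have idx := sorted_leq_index leq_trans leqnn srt.
apply/idP/idP => [|le]; first exact: idx.
rewrite leqNgt; apply/negP => lt.
have := idx _ _ (ms k) (ms j) (ltnW lt) => ge.
by move: lt; rewrite (_ : A i j = A i k) ?ltnn //; apply/eqP; rewrite eqn_leq le.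
Qed.

Lemma column_neq0 j : ~ principal I -> column A j != 0%MM.
Proof.
move=> nonpr; apply/eqP => A0; apply: nonpr; apply: (@principal_of_least_column j) => k.
by rewrite A0; apply/mnm_lepP => i; rewrite mnm0E.
Qed.

(** A zero column of the signature consists of row minima, so that column of [A]
    divides all the others. *)
Lemma sgn_column_neq0 j : ~ principal I -> column (sgn_mx A) j != 0%MM.
Proof.
move=> nonpr; apply/eqP => A0; apply: nonpr; apply: (@principal_of_least_column j) => k.
apply/mnm_lepP => i; rewrite !mnmE -sgn_mx_le.
by have /mnmP/(_ i) := A0; rewrite mnmE mnm0E => ->.
Qed.

End Columns.

(** The columns are the minimal monomials of the ideal. *)
Lemma incidence_matrix_unique I q (A : 'M[nat]_(n, q)) q' (A' : 'M[nat]_(n, q')) j :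
  incidence_matrix I A -> incidence_matrix I A' -> exists k, column A k = column A' j.
Proof.
move=> incA incA'.
have [k leA] := column_below incA (column_mem incA' j).
have [l leA'] := column_below incA' (column_mem incA k).
exists k; have lj := column_minimal incA' (lepm_trans leA' leA); subst l.
by apply/mnmP => i; apply/eqP; rewrite eqn_leq (mnm_lepP leA) (mnm_lepP leA').
Qed.

(** Two incidence matrices have the same columns, so corresponding rows have the
    same sets of entries, and the ranks agree. *)
Lemma sgn_column_unique I q (A : 'M[nat]_(n, q)) q' (A' : 'M[nat]_(n, q')) j :
  incidence_matrix I A -> incidence_matrix I A' ->
  exists k, column (sgn_mx A) k = column (sgn_mx A') j.
Proof.
move=> incA incA'; have [k ekj] := incidence_matrix_unique j incA incA'.
have sub q1 (B : 'M[nat]_(n, q1)) q2 (C : 'M[nat]_(n, q2)) i :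
    incidence_matrix I B -> incidence_matrix I C -> {subset codom (B i) <= codom (C i)}.
  move=> incB incC _ /codomP[l ->].
  have [m /mnmP/(_ i)] := incidence_matrix_unique l incC incB.
  by rewrite !mnmE => <-; apply: codom_f.
exists k; apply/mnmP => i; rewrite !mnmE !mxE.
have /mnmP/(_ i) := ekj; rewrite !mnmE => ->; congr (index _ _).
apply/(perm_sortP leq_total leq_trans anti_leq).
apply: uniq_perm; rewrite ?undup_uniq // => x; rewrite !mem_undup.
by apply/idP/idP; apply: sub.
Qed.

End IncidenceMatrix.

Theorem theorem2p28 (K : fieldType) (n : nat) (I : {mpoly K[n]} -> Prop)
    (I_monomial : monomial_ideal I) (I_nonprincipal : ~ principal I) :
  exists d : nat,
    depth_quotient_is I d /\ depth_quotient_is (sgn_ideal I) d.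
Proof.
have [q [A incA]] := incidence_matrix_exists I_monomial.
have IA := proj1 incA; have AI p := iff_sym (IA p).
have sgnI : same_set (sgn_ideal I) (monomial_gen (columns_in (sgn_mx A) setT)).
  apply: monomial_gen_ext => w; split=> [[q' [A' [incA' [j _ ->]]]]|Aw].
    by have [k <-] := sgn_column_unique j incA incA'; exists k.
  by exists q, A.
have Isgn p := iff_sym (sgnI p).
have A0 s : columns_in A setT s -> s != 0%MM.
  by case=> j _ ->; apply: column_neq0 incA _ _.
have sgnA0 s : columns_in (sgn_mx A) setT s -> s != 0%MM.
  by case=> j _ ->; apply: sgn_column_neq0 incA _ _.
apply: depth_eq_of_koszul.
- split=> [|p r /IA Ip /IA Ir|r p /IA Ip]; apply/IA; have idA := ideal_gen_is_ideal.
  + by apply: ideal0; apply: idA.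
  + by apply: idealD => //; apply: idA.
  + by apply: idealM => //; apply: idA.
- by move=> p /IA; apply: monomial_gen_irrelevant.
- exact: ideal_gen_is_ideal.
- by move=> p /sgnI; apply: monomial_gen_irrelevant.
move=> i; split=> ex.
- apply: (koszul_exact_ext Isgn); apply: koszul_exact_of_acyclic.
  apply: (acyclic_same_pattern (A := A)) => [r j k|a]; first by rewrite sgn_mx_le.
  by apply: acyclic_of_koszul_exact A0 _; apply: koszul_exact_ext ex.
- apply: (koszul_exact_ext AI); apply: koszul_exact_of_acyclic.
  apply: (acyclic_same_pattern (A := sgn_mx A)) => [r j k|a]; first exact: sgn_mx_le.
  by apply: acyclic_of_koszul_exact sgnA0 _; apply: koszul_exact_ext ex.
Qed.
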